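(* Let $X$ be a vector space over $\mathbb{R}$ or $\mathbb{C}$, let $\rho : X \to [0,+\infty]$ be a modular, and let $X_\rho$ be the associated modular space. Then $\rho$ satisfies the $\Delta_2$-condition if and only if for every $\varepsilon > 0$ there exist $L > 0$ and $\delta > 0$ such that for all $x, y \in X_\rho$: if $\rho(x) < L$ and $\rho(x-y) < \delta$, then $|\rho(y) - \rho(x)| < \varepsilon$.
   Context: A modular on a vector space $X$ over $\mathbb{R}$ or $\mathbb{C}$ is a map $\rho : X \to [0,+\infty]$ such that for all $x,y \in X$: (i) $\rho(x) = 0$ if and only if $x = 0$; (ii) $\rho(-x) = \rho(x)$ in the real case, and $\rho(e^{it}x) = \rho(x)$ for all $t \in \mathbb{R}$ in the complex case; (iii) $\rho(\alpha x + \beta y) \le \rho(x) + \rho(y)$ whenever $\alpha, \beta \ge 0$ and $\alpha + \beta = 1$. The associated modular space is $X_\rho = \{x \in X : \rho(\lambda x) \to 0 \text{ as } \lambda \to 0\}$, a vector subspace of $X$. $\Delta_2$-condition: for every sequence $(x_n)_{n \in \mathbb{N}}$ in $X_\rho$, if $\lim_{n\to\infty} \rho(x_n) = 0$ then $\lim_{n\to\infty} \rho(2x_n) = 0$. *)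

(* Defs.v *)
From HB Require Import structures.
From mathcomp Require Import all_boot all_order all_algebra.
From mathcomp Require Import complex.
From mathcomp Require Import all_classical all_reals all_analysis.

Set Implicit Arguments.
Unset Strict Implicit.
Unset Printing Implicit Defensive.

Import Order.TTheory GRing.Theory Num.Theory.
Import numFieldNormedType.Exports.

Local Open Scope classical_set_scope.
Local Open Scope ring_scope.
Local Open Scope complex_scope.

(* A modular takes values in [0, +oo] and vanishes only at 0; [modular_base]
   collects these two clauses. In [modular_convex] the scalars range over a
   [numFieldType] K; for K = R[i], [0 <= a] holds exactly when a is a
   nonnegative real, so the clause quantifies over real a, b >= 0 as it should. *)
Definition modular_base (R : realType) (K : numFieldType) (X : lmodType K)
    (rho : X -> \bar R) : Prop :=
  (forall x : X, (0 <= rho x)%E) /\ (forall x : X, rho x = 0%E <-> x = 0).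

Definition modular_convex (R : realType) (K : numFieldType) (X : lmodType K)
    (rho : X -> \bar R) : Prop :=
  forall (a b : K) (x y : X), 0 <= a -> 0 <= b -> a + b = 1 ->
    (rho (a *: x + b *: y)%R <= rho x + rho y)%E.

Definition real_modular (R : realType) (X : lmodType R)
    (rho : X -> \bar R) : Prop :=
  [/\ modular_base rho,
      forall x : X, rho (- x) = rho x
    & modular_convex rho].

Definition complex_modular (R : realType) (X : lmodType R[i])
    (rho : X -> \bar R) : Prop :=
  [/\ modular_base rho,
      (* cos t +i* sin t is e^{it} *)
      forall (t : R) (x : X), rho ((cos t +i* sin t) *: x) = rho x
    & modular_convex rho].

Definition modular_space (R : realType) (K : numFieldType) (X : lmodType K)
    (rho : X -> \bar R) : set X :=
  [set x : X | rho (l *: x) @[l --> (0 : K)^'] --> (0%E : \bar R)].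

Definition Delta2 (R : realType) (K : numFieldType) (X : lmodType K)
    (rho : X -> \bar R) : Prop :=
  forall x : nat -> X, (forall n, modular_space rho (x n)) ->
    rho (x n) @[n --> \oo] --> (0%E : \bar R) ->
    rho (2 *: x n) @[n --> \oo] --> (0%E : \bar R).

(* Main.v *)
Require Import Defs.
From HB Require Import structures.
From mathcomp Require Import all_boot all_order all_algebra.
From mathcomp Require Import complex lra.
From mathcomp Require Import all_classical all_reals all_analysis.

Set Implicit Arguments.
Unset Strict Implicit.
Unset Printing Implicit Defensive.

Import Order.TTheory GRing.Theory Num.Theory.
Import numFieldNormedType.Exports.

Local Open Scope classical_set_scope.
Local Open Scope ring_scope.

(* Writing x + y as the midpoint of 2x and 2y gives
   rho (x + y) <= rho (2x) + rho (2y). If small rho forces small rho (2 .), this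
   bounds rho y for y = x + (y - x); conversely, apply the continuity condition
   to the pair x, 2x, whose difference -x has modular rho x. *)

(** Nonnegativity supplies the lower bound, so only the upper one has to be checked. Conversely, the
    bound with [e = 1] makes [f] eventually finite, and the limit can then be computed on real
    values. *)
Lemma ge0_cvge0P (R : realType) (T : Type) (F : set_system T) (f : T -> \bar R) :
  Filter F -> (forall t, 0 <= f t)%E ->
  f @ F --> (0%E : \bar R) <->
  forall e : R, 0 < e -> \forall t \near F, (f t < e%:E)%E.
Proof.
move=> FF f0; split => [cf e e0|cf].
  apply: (cf [set y | (y < e%:E)%E]).
  by apply: open_nbhs_nbhs; split; [exact: open_ereal_lt_ereal|rewrite /= lte_fin].
apply/fine_cvgP; split.
  near=> t; rewrite fin_numElt (lt_le_trans _ (f0 t)) ?ltNy0//=.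
  by rewrite (@lt_trans _ _ 1%:E) ?ltry//; near: t; exact: cf.
apply/cvgrPdist_lt => e e0; near=> t.
have fte : (f t < e%:E)%E by near: t; exact: cf.
have ftf : f t \is a fin_num by rewrite ge0_fin_numE// (lt_trans fte) ?ltry.
rewrite sub0r normrN ger0_norm ?fine_ge0//.
by rewrite -lte_fin fineK.
Unshelve. all: by end_near. Qed.

Lemma dnbhs0_scale (K : numFieldType) (P : set K) (c : K) : c != 0 ->
  (\forall l \near (0 : K)^', P l) -> \forall l \near (0 : K)^', P (c * l).
Proof.
move=> c0 /nbhs_ballP[e /= e0 Pe]; apply/nbhs_ballP.
exists (e / `|c|) => /=; first by rewrite divr_gt0 ?normr_gt0.
move=> l; rewrite /ball /= sub0r normrN => le l0.
apply: Pe; last by rewrite mulf_neq0.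
by rewrite /ball /= sub0r normrN normrM mulrC -ltr_pdivlMr ?normr_gt0.
Qed.

(** Evenness is all that is kept of the symmetry axiom, and both the real and the complex axiom
    imply it; one argument over [K] thus serves both cases. *)
Section Modular.
Variables (R : realType) (K : numFieldType) (X : lmodType K) (rho : X -> \bar R).
Hypotheses (rho_base : modular_base rho) (rhoN : forall x, rho (- x) = rho x)
  (rho_conv : modular_convex rho).

Let rho_ge0 x : (0 <= rho x)%E. Proof. exact: rho_base.1. Qed.

Lemma modular_spaceP x : modular_space rho x <->
  forall e : R, 0 < e -> \forall l \near (0 : K)^', (rho (l *: x) < e%:E)%E.
Proof. by apply: ge0_cvge0P => l; exact: rho_ge0. Qed.

Lemma modularD_le x y : (rho (x + y)%R <= rho (2 *: x) + rho (2 *: y))%E.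
Proof.
have half0 : 0 <= 2^-1 :> K by rewrite invr_ge0.
have halfD : 2^-1 + 2^-1 = 1 :> K by have := splitr (1 : K); rewrite div1r => <-.
have := rho_conv (2 *: x) (2 *: y) half0 half0 halfD.
by rewrite !scalerA mulVf ?pnatr_eq0// !scale1r.
Qed.

(** As [l] tends to 0 through nonzero values, so does [c * l]; this is where [c != 0] enters. *)
Lemma modular_spaceZ c x : c != 0 -> modular_space rho x ->
  modular_space rho (c *: x).
Proof.
move=> c0 /modular_spaceP xs; apply/modular_spaceP => e e0.
have /= := dnbhs0_scale c0 (xs e e0).
by apply: filterS => l; rewrite scalerA mulrC.
Qed.

Lemma modular_spaceB x y : modular_space rho x -> modular_space rho y ->
  modular_space rho (x - y).
Proof.
have two0 : 2 != 0 :> K by rewrite pnatr_eq0.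
move=> /(modular_spaceZ two0)/modular_spaceP xs.
move=> /(modular_spaceZ two0)/modular_spaceP ys.
apply/modular_spaceP => e e0; have e20 : 0 < e / 2 by rewrite divr_gt0.
apply: filterS2 (xs _ e20) (ys _ e20) => l xl yl.
rewrite scalerBr (le_lt_trans (modularD_le _ _))// scalerN rhoN.
by rewrite (splitr e) EFinD lteD// scalerA mulrC -scalerA.
Qed.

(** If no [d] works for some [e], choosing a counterexample for each [d = 1/(n+1)] gives a sequence
    that violates the sequential condition. *)
Lemma Delta2P : Delta2 rho <-> forall e : R, 0 < e -> exists2 d : R, 0 < d &
  forall x, modular_space rho x -> (rho x < d%:E)%E -> (rho (2 *: x) < e%:E)%E.
Proof.
split=> [D2 e e0|D2 x xs].
  apply: contrapT => nd.
  have {nd} bad n : exists x, [/\ modular_space rho x,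
      (rho x < n.+1%:R^-1%:E)%E & ~ (rho (2 *: x) < e%:E)%E].
    apply: contrapT => nx; apply: nd; exists n.+1%:R^-1; first by rewrite invr_gt0.
    by move=> x xs xn; apply: contrapT => xe; apply: nx; exists x.
  have /choice[u uP] := bad.
  have /D2 : forall n, modular_space rho (u n) by move=> n; have [] := uP n.
  have u0 : rho (u n) @[n --> \oo] --> (0%E : \bar R).
    apply/ge0_cvge0P => [n|d d0]; first exact: rho_ge0.
    near=> n; have [_ un _] := uP n; apply: (lt_trans un).
    by rewrite lte_fin; near: n; exact: (near_infty_natSinv_lt (PosNum d0)).
  move=> /(_ u0)/(@ge0_cvge0P _ _ _ _ _ (fun=> rho_ge0 _))/(_ e e0).
  (* Every term of [u] is bad, so the first index covered by the eventual bound already gives a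
     contradiction. *)
  move=> [N _ /(_ N (leqnn N))].
  by have [] := uP N.
move=> /(@ge0_cvge0P _ _ _ _ _ (fun=> rho_ge0 _)) x0.
apply/ge0_cvge0P => [n|e e0]; first exact: rho_ge0.
have [d d0 dP] := D2 e e0.
by apply: filterS (x0 d d0) => n; exact: dP.
Unshelve. all: by end_near. Qed.

Lemma Delta2_continuousP : Delta2 rho <->
  forall eps : R, 0 < eps ->
    exists L : R, exists delta : R, [/\ 0 < L, 0 < delta &
      forall x y : X, modular_space rho x -> modular_space rho y ->
        (rho x < L%:E)%E -> (rho (x - y)%R < delta%:E)%E ->
        (`|rho y - rho x| < eps%:E)%E].
Proof.
rewrite Delta2P; split=> [D2 e e0|cont e e0].
  (* With [e / 2], the two terms bounding [rho y], namely [rho (2x)] and [rho (2(y - x))], add up to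
     less than [e]. *)
  have [d d0 dP] := D2 _ (divr_gt0 e0 (ltr0n _ 2)).
  (* Once both rho x and rho y lie in [0, eps[, so does their distance. *)
  exists (Num.min d e), d; split=> // [|x y xs ys]; first by rewrite lt_min d0.
  rewrite EFin_min lt_min => /andP[xd xe] xyd.
  have ye : (rho y < e%:E)%E.
    rewrite -(subrKC x y) (le_lt_trans (modularD_le _ _))//.
    rewrite (splitr e) EFinD lteD//; apply: dP => //.
      exact: modular_spaceB.
    by rewrite -rhoN opprB.
  move: xe ye (rho_ge0 x) (rho_ge0 y).
  case: (rho x) => [a| |]//; case: (rho y) => [b| |]//.
  by rewrite -EFinB abse_EFin !lte_fin !lee_fin ltr_norml => *; apply/andP; split; lra.
have e20 : 0 < e / 2 by rewrite divr_gt0.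
have [L [d [L0 d0 H]]] := cont _ e20.
(* [L] and [d] allow [H] to be applied to [x] and [2x]; [e / 2] gives
   [rho (2x) < rho x + e / 2 < e]. *)
exists (Num.min (Num.min L d) (e / 2)); first by rewrite !lt_min L0 d0.
move=> x xs; rewrite !EFin_min !lt_min => /andP[/andP[xL xd] xe].
have two0 : 2 != 0 :> K by rewrite pnatr_eq0.
have x2x : x - 2 *: x = - x by rewrite scaler_nat mulr2n opprD addNKr.
have := H x (2 *: x) xs (modular_spaceZ two0 xs) xL.
rewrite x2x rhoN => /(_ xd).
move: xe (rho_ge0 x) (rho_ge0 (2 *: x)).
(* The value [+oo] for [rho (2x)] is impossible, since its distance to the finite [rho x] would be
   infinite. *)
case: (rho x) => [a| |]//; case: (rho (2 *: x)) => [b| |]//.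
by rewrite -EFinB abse_EFin !lte_fin !lee_fin ltr_norml => ? ? ? /andP[? ?]; lra.
Qed.

End Modular.

Theorem mainTheorem1 (R : realType) :
  (forall (X : lmodType R) (rho : X -> \bar R), real_modular rho ->
    (Delta2 rho <->
     forall eps : R, 0 < eps ->
       exists L : R, exists delta : R, [/\ 0 < L, 0 < delta &
         forall x y : X, modular_space rho x -> modular_space rho y ->
           (rho x < L%:E)%E -> (rho (x - y)%R < delta%:E)%E ->
           (`|rho y - rho x| < eps%:E)%E]))
  /\
  (forall (X : lmodType (complex R)) (rho : X -> \bar R), complex_modular rho ->
    (Delta2 rho <->
     forall eps : R, 0 < eps ->
       exists L : R, exists delta : R, [/\ 0 < L, 0 < delta &
         forall x y : X, modular_space rho x -> modular_space rho y ->
           (rho x < L%:E)%E -> (rho (x - y)%R < delta%:E)%E ->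
           (`|rho y - rho x| < eps%:E)%E])).
Proof.
split=> [X rho [rb rN rc]|X rho [rb re rc]]; first exact: Delta2_continuousP.
apply: Delta2_continuousP => // x.
(* Evenness is rotation invariance at [t = pi], where the scalar is -1. *)
have <- : (Complex (cos pi) (sin pi) : complex R) *: x = - x.
  by rewrite cospi sinpi -[RHS]scaleN1r; congr (_ *: _); apply/eqP; rewrite eq_complex /= oppr0 !eqxx.
exact: re.
Qed.
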